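(* Let $f:\mathbb X\to\mathbb Y$ be a mapping between normed spaces, let $\bar x\in\mathbb X$ and let $\epsilon>0$. (1) If $h\in\mathcal H(\mathbb X,\mathbb Y)$ is a first-order $\epsilon$-approximation of $f$ at $\bar x$ with $\alpha_0(h)>\epsilon$, then $f$ is strongly metrically subregular at $\bar x$ and $$\mathrm{subreg}\,f(\bar x)\le\frac{1}{\alpha_0(h)-\epsilon}.$$ (2) Vice versa, if $f$ is strongly metrically subregular at $\bar x$, then for any mapping $h\in\mathcal H(\mathbb X,\mathbb Y)$ which is a first-order $\epsilon$-approximation of $f$ at $\bar x$, with $\epsilon<\dfrac{1}{\mathrm{subreg}\,f(\bar x)}$ (where $1/0=+\infty$), one has $$\alpha_0(h)\ge\frac{1}{\mathrm{subreg}\,f(\bar x)}-\epsilon,$$ so $h$ is strongly metrically subregular at $\mathbf 0$.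
   Context: $B(x,r)$ denotes the closed ball with center $x$ and radius $r$; $\mathbf 0$ is the null vector. A mapping $f:\mathbb X\to\mathbb Y$ is metrically subregular at $\bar x$ if there exist $\kappa\ge 0$ and $r>0$ such that $\mathrm{dist}(x,f^{-1}(f(\bar x)))\le\kappa\|f(x)-f(\bar x)\|$ for all $x\in B(\bar x,r)$; the modulus $\mathrm{subreg}\,f(\bar x)$ is the infimum of all $\kappa\ge 0$ for which such an $r$ exists. It is strongly metrically subregular at $\bar x$ if, in addition, $\bar x$ is an isolated point of $f^{-1}(f(\bar x))$; equivalently, if there exist $\kappa\ge0$, $r>0$ with $\|x-\bar x\|\le\kappa\|f(x)-f(\bar x)\|$ for all $x\in B(\bar x,r)$. The calmness modulus $\mathrm{clm}\,g(\bar x)$ of a mapping $g:\mathbb X\to\mathbb Y$ at $\bar x$ is the infimum of all $\kappa\ge0$ for which there exists $r>0$ such that $\|g(x)-g(\bar x)\|\le\kappa\|x-\bar x\|$ for all $x\in B(\bar x,r)$ ($+\infty$ if there is no such $\kappa$). $\mathcal H(\mathbb X,\mathbb Y)$ is the set of all mappings $h:\mathbb X\to\mathbb Y$ that are positively homogeneous ($h(tx)=th(x)$ for all $x\in\mathbb X$, $t>0$) and continuous at $\mathbf 0$. For $h\in\mathcal H(\mathbb X,\mathbb Y)$, $\alpha_0(h)=\inf_{\|u\|=1}\|h(u)\|$. Given $\epsilon>0$, $h\in\mathcal H(\mathbb X,\mathbb Y)$ is a first-order $\epsilon$-approximation of $f$ at $\bar x$ if $\mathrm{clm}\,(f-h(\cdot-\bar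 x))(\bar x)<\epsilon$. *)

(* Defs.v *)
From HB Require Import structures.
From mathcomp Require Import all_boot all_order all_algebra.
From mathcomp Require Import all_classical all_reals all_analysis.

Set Implicit Arguments.
Unset Strict Implicit.
Unset Printing Implicit Defensive.

Import Order.TTheory GRing.Theory Num.Theory.
Import numFieldNormedType.Exports.

Local Open Scope classical_set_scope.
Local Open Scope ring_scope.

(* All moduli are infima in [\bar R], where [ereal_inf set0 = +oo]. *)

(* The library's point-to-set distance is defined from balls; on a normed
   space it is the infimum of the norms of the differences. *)
Lemma edist_inf_normE (R : realType) (X : normedModType R) (A : set X)
    (x : X) :
  edist_inf A x = ereal_inf [set (`|x - a|)%:E | a in A].
Proof.
congr ereal_inf; apply: eq_imagel => a _.
apply/le_anti/andP; split.
- apply/lee_addgt0Pr => e e0; rewrite -EFinD.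
  apply: ereal_inf_lbound; exists (`|x - a| + e) => //; split.
    by rewrite ltr_wpDl.
  by rewrite -ball_normE /= ltrDl.
- apply: le_ereal_inf_tmp => _ [r [r0]] + <-.
  by rewrite -ball_normE /= lee_fin => /ltW.
Qed.

Section Definitions.
Variables (R : realType) (X Y : normedModType R).
Implicit Types (f g h : X -> Y) (xbar : X).

Definition subreg_const f xbar : set R :=
  [set kappa | 0 <= kappa /\ exists2 r : R, 0 < r &
    forall x, closed_ball xbar r x ->
      (edist_inf (f @^-1` [set f xbar]) x
         <= (kappa * `|f x - f xbar|)%:E)%E].

Definition metrically_subregular f xbar : Prop :=
  subreg_const f xbar !=set0.

Definition subreg f xbar : \bar R :=
  ereal_inf (EFin @` subreg_const f xbar).

Definition strongly_metrically_subregular f xbar : Prop :=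
  metrically_subregular f xbar /\ isolated (f @^-1` [set f xbar]) xbar.

Definition calm_const g xbar : set R :=
  [set kappa | 0 <= kappa /\ exists2 r : R, 0 < r &
    forall x, closed_ball xbar r x ->
      `|g x - g xbar| <= kappa * `|x - xbar|].

Definition clm g xbar : \bar R := ereal_inf (EFin @` calm_const g xbar).

Definition pos_homogeneous h : Prop :=
  forall (t : R) (x : X), 0 < t -> h (t *: x) = t *: h x.

Definition calH : set (X -> Y) :=
  [set h | pos_homogeneous h /\ {for 0, continuous h}].

(* Equal to [+oo] when [X] is the zero space, whose unit sphere is empty. *)
Definition alpha0 h : \bar R :=
  ereal_inf [set (`|h u|)%:E | u in [set u : X | `|u| = 1]].

Definition first_order_approx (eps : R) f xbar h : Prop :=
  (clm (fun x => f x - h (x - xbar))%R xbar < eps%:E)%E.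

End Definitions.

Arguments calH {R} X Y.

(* Main.v *)
Require Import Defs.
From HB Require Import structures.
From mathcomp Require Import all_boot all_order all_algebra.
From mathcomp Require Import all_classical all_reals all_analysis.
From mathcomp Require Import lra.

Set Implicit Arguments.
Unset Strict Implicit.
Unset Printing Implicit Defensive.

Import Order.TTheory GRing.Theory Num.Theory.
Import numFieldNormedType.Exports.

Local Open Scope classical_set_scope.
Local Open Scope ring_scope.
Local Open Scope ereal_scope.

(** An isolated point [xbar] of a fiber of [f] is the point of that fiber
nearest to every [x] close to [xbar], so strong subregularity with constant
[kappa] is the local error bound [`|x - xbar| <= kappa * `|f x - f xbar|]
([isolated_error_bound], with converse in [error_bound_subreg_const] and
[error_bound_isolated]).  Near [xbar], [f x - f xbar] differs from
[h (x - xbar)] by at most [c * `|x - xbar|] for some [c < eps]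
([first_order_approxP]); both halves compare these two quantities.

By homogeneity [`|h v|] is at least [alpha0 h * `|v|], so the triangle
inequality bounds [`|f x - f xbar|] from below by
[(alpha0 h - eps) * `|x - xbar|], which is the error bound with constant the
inverse of [alpha0 h - eps] ([alpha0_strongly_subregular]).

Conversely, inserting [x = xbar + t *: u], for a unit vector [u] and a small
[t > 0], into the error bound of [f] and dividing by [t] gives
[1 <= kappa * (`|h u| + eps)] ([subreg_const_unit_vector]).  Passing to the
infimum over [kappa], then over [u], bounds [alpha0 h] from below
([alpha0_ge_subregV]); since this bound is positive, [h] satisfies an error
bound at [0] in its turn ([calH_strongly_subregular]).

Infinite values need no separate argument in the second half, where each
infimum is handled through its lower bounds.  In the first half,
[alpha0 h = +oo] means that every real number minorizes [alpha0 h], so that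
[subreg f xbar] is below every positive number. *)

Section StrongSubregularity.
Context {R : realType} {X Y : normedModType R}.
Implicit Types (f g h : X -> Y) (xbar : X) (kappa c : R).

(** Radii of closed balls are traded for neighborhoods, so that local bounds
can be combined as filter statements. *)
Lemma near_closed_ballP (P : X -> Prop) xbar :
  (exists2 r : R, (0 < r)%R & forall x, closed_ball xbar r x -> P x) <->
  \forall x \near xbar, P x.
Proof.
split=> [[r r0 Pr]|/nbhs_closedballP[r Pr]].
  by apply/nbhs_closedballP; exists (PosNum r0).
by exists r%:num%R.
Qed.

(** Inside half the radius of isolation, [xbar] is at least as close to [x] as
any other point of [A]. *)
Lemma edist_inf_isolated (A : set X) xbar : isolated A xbar ->
  \forall x \near xbar, edist_inf A x = (`|x - xbar|)%:E.
Proof.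
move=> [/set_mem Axbar [V /nbhs_ballP[rho /= rho0 rhoV] VA]].
have rho2 : (0 < rho / 2)%R by rewrite divr_gt0.
apply/nbhs_ballP; exists (rho / 2)%R => //= x.
rewrite -ball_normE /= distrC => xxbar.
rewrite edist_inf_normE; apply/le_anti/andP; split.
  by apply: ereal_inf_lbound; exists xbar.
apply: le_ereal_inf_tmp => _ [a Aa <-]; rewrite lee_fin.
have [->//|axbar] := eqVneq a xbar.
have rhoa : (rho <= `|xbar - a|)%R.
  rewrite leNgt; apply: contra axbar => xbara; apply/eqP.
  have : (V `&` A) a by split=> //; apply: rhoV; rewrite -ball_normE.
  by rewrite VA.
(* A point of [A] other than [xbar] is at distance at least [rho] from [xbar],
   hence at least [rho / 2] from [x]. *)
have := ler_distD x xbar a; rewrite (distrC xbar x); lra.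
Qed.

Lemma error_bound_subreg_const f xbar kappa : (0 <= kappa)%R ->
  (\forall x \near xbar, `|x - xbar| <= kappa * `|f x - f xbar|)%R ->
  subreg_const f xbar kappa.
Proof.
move=> kappa0 bnd; split=> //; apply/near_closed_ballP.
apply: filterS bnd => x /= xP; rewrite edist_inf_normE.
by apply: ge_ereal_inf; exists (`|x - xbar|)%:E; [exists xbar|rewrite lee_fin].
Qed.

Lemma error_bound_isolated f xbar kappa :
  (\forall x \near xbar, `|x - xbar| <= kappa * `|f x - f xbar|)%R ->
  isolated (f @^-1` [set f xbar]) xbar.
Proof.
move=> bnd; split; first exact/mem_set.
exists [set x | `|x - xbar| <= kappa * `|f x - f xbar|]%R => //.
apply/seteqP; split=> x /= => [[+ fx]|->]; last by rewrite !subrr !normr0 mulr0.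
by rewrite fx subrr normr0 mulr0 normr_le0 subr_eq0 => /eqP.
Qed.

(** By isolation, the distance from [x] to the fiber is [`|x - xbar|]. *)
Lemma isolated_error_bound f xbar kappa :
  isolated (f @^-1` [set f xbar]) xbar -> subreg_const f xbar kappa ->
  (\forall x \near xbar, `|x - xbar| <= kappa * `|f x - f xbar|)%R.
Proof.
move=> /edist_inf_isolated dist [_ /near_closed_ballP bnd].
by near=> x; rewrite -lee_fin -(near dist x) //; near: x.
Unshelve. all: by end_near. Qed.

Lemma lower_bound_strongly_subregular f xbar (b : R) : (0 < b)%R ->
  (\forall x \near xbar, b * `|x - xbar| <= `|f x - f xbar|)%R ->
  strongly_metrically_subregular f xbar /\ subreg f xbar <= (b^-1)%:E.
Proof.
move=> b0 bnd.
have eb : (\forall x \near xbar, `|x - xbar| <= b^-1 * `|f x - f xbar|)%R.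
  by apply: filterS bnd => x; rewrite ler_pdivlMl.
have bV0 : (0 <= b^-1)%R by rewrite invr_ge0 ltW.
have sc := error_bound_subreg_const bV0 eb.
split; last by apply: ereal_inf_lbound; exists b^-1%R.
by split; [exists b^-1%R|exact: error_bound_isolated eb].
Qed.

(** Homogeneity with factor 2 gives [h 0 = h 0 + h 0]. *)
Lemma calH0 h : calH X Y h -> h 0%R = 0%R.
Proof.
move=> [hom _]; have := hom 2%R 0%R (ltr0Sn _ 1).
by rewrite scaler0 scaler_nat mulr2n => /eqP; rewrite -subr_eq0 opprD addNKr
  oppr_eq0 => /eqP.
Qed.

(** The remainder vanishes at [xbar] because [h 0 = 0], so its calmness is a
bound on its own norm. *)
Lemma first_order_approxP (eps : R) f xbar h : calH X Y h ->
  first_order_approx eps f xbar h ->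
  exists2 c, (c < eps)%R & (\forall x \near xbar,
    `|(f x - f xbar) - h (x - xbar)| <= c * `|x - xbar|)%R.
Proof.
move=> Hh /ereal_inf_lt[_ [c [_ /near_closed_ballP bnd] <-]].
rewrite lte_fin => ceps; exists c => //; apply: filterS bnd => x.
by rewrite subrr calH0// subr0 addrAC.
Qed.

Lemma alpha0_le h (a : R) (v : X) : calH X Y h -> a%:E <= alpha0 h ->
  (a * `|v| <= `|h v|)%R.
Proof.
move=> Hh ah; have [->|v0] := eqVneq v 0%R.
  by rewrite normr0 mulr0.
have nv0 : (0 < `|v|)%R by rewrite normr_gt0.
rewrite -ler_pdivlMr// -lee_fin (le_trans ah)//.
apply: ereal_inf_lbound; exists (`|v|^-1 *: v)%R => /=.
  by rewrite normrZ normfV normr_id mulVf ?gt_eqF.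
by rewrite Hh.1 ?invr_gt0// normrZ normfV normr_id mulrC.
Qed.

(** Stated with a real [b] instead of [alpha0 h - eps], so that it also covers
[alpha0 h = +oo], where every [b > 0] is allowed. *)
Lemma alpha0_strongly_subregular (eps b : R) f xbar h : calH X Y h ->
  first_order_approx eps f xbar h -> (0 < b)%R -> (b + eps)%:E <= alpha0 h ->
  strongly_metrically_subregular f xbar /\ subreg f xbar <= (b^-1)%:E.
Proof.
move=> Hh /(first_order_approxP Hh)[c ceps approx] b0 bh.
apply: lower_bound_strongly_subregular => //.
apply: filterS approx => x /= bnd.
have hx := alpha0_le (x - xbar)%R Hh bh.
have := lerB_dist (h (x - xbar)%R) (f x - f xbar)%R; rewrite (distrC (h _)).
have : (c * `|x - xbar| <= eps * `|x - xbar|)%R by rewrite ler_wpM2r// ltW.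
lra.
Qed.

(** The error bound at [xbar + t *: u] and the approximation give
[t <= kappa * (t * `|h u| + eps * t)], which is then divided by [t]. *)
Lemma subreg_const_unit_vector (eps kappa : R) f xbar h (u : X) : calH X Y h ->
  first_order_approx eps f xbar h -> isolated (f @^-1` [set f xbar]) xbar ->
  subreg_const f xbar kappa -> `|u|%R = 1%R ->
  (1 <= kappa * (`|h u| + eps))%R.
Proof.
move=> Hh /(first_order_approxP Hh)[c ceps approx] iso sc u1.
have eb := isolated_error_bound iso sc.
have [r r0 rP] := (near_closed_ballP _ _).2 (filterI approx eb).
have t0 : (0 < r / 2)%R by rewrite divr_gt0.
set t : R := (r / 2)%R in t0.
have ntu : `|t *: u|%R = t by rewrite normrZ u1 mulr1 gtr0_norm.
have : closed_ball xbar r (xbar + t *: u)%R.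
  apply: subset_closed_ball; rewrite -ball_normE /= opprD addNKr normrN ntu /t; lra.
move=> /rP /= []; rewrite (addrC xbar) addrK ntu => bnd eb1.
have k0 : (0 <= kappa)%R := sc.1.
have htu : `|h (t *: u)|%R = (t * `|h u|)%R by rewrite Hh.1// normrZ gtr0_norm.
have tri := lerB_dist (f (t *: u + xbar) - f xbar)%R (h (t *: u)).
have ct : (c * t <= eps * t)%R by rewrite ler_wpM2r// ltW.
have ft : (`|f (t *: u + xbar) - f xbar| <= t * (`|h u| + eps))%R by lra.
rewrite -(ler_pM2l t0) mulr1 (le_trans eb1)// mulrCA.
by rewrite ler_wpM2l.
Qed.

Lemma subreg_ge0 f xbar : 0 <= subreg f xbar.
Proof. by apply: le_ereal_inf_tmp => _ [k [k0 _] <-]; rewrite lee_fin. Qed.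

(** Taking inverses turns the claim for a unit vector [u] into
[(`|h u| + eps)^-1 <= subreg f xbar], which can be checked on each admissible
constant; infinite inverses then need no case analysis. *)
Lemma alpha0_ge_subregV (eps : R) f xbar h : (0 < eps)%R -> calH X Y h ->
  first_order_approx eps f xbar h -> strongly_metrically_subregular f xbar ->
  (subreg f xbar)^-1 - eps%:E <= alpha0 h.
Proof.
move=> eps0 Hh approx [_ iso]; apply: le_ereal_inf_tmp => _ [u /= u1 <-].
have b0 : (0 < `|h u| + eps)%R by rewrite ltr_wpDl.
suff : (subreg f xbar)^-1 <= (`|h u| + eps)%:E by rewrite EFinD -leeBlDr.
rewrite inve_ple ?inE ?subreg_ge0 ?lee_fin ?(ltW b0)//.
rewrite inver gt_eqF//.
apply: le_ereal_inf_tmp => _ [kappa sc <-].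
rewrite lee_fin -[(_^-1)%R]mul1r ler_pdivrMr//.
exact: (subreg_const_unit_vector Hh approx iso sc u1).
Qed.

(** By homogeneity, a positive lower bound on the unit sphere is a global error
bound at [0]. *)
Lemma calH_strongly_subregular h : calH X Y h -> 0 < alpha0 h ->
  strongly_metrically_subregular h 0%R.
Proof.
move=> Hh h0.
have [b b0 bh] : exists2 b : R, (0 < b)%R & b%:E <= alpha0 h.
  case: (alpha0 h) h0 => [r| |]//; first by exists r.
  by exists 1%R; rewrite ?leey.
apply: (lower_bound_strongly_subregular b0 _).1.
by apply: nearW => x; rewrite calH0// !subr0; exact: alpha0_le.
Qed.

End StrongSubregularity.

Theorem theorem4 (R : realType) (X Y : normedModType R) (f : X -> Y)
    (xbar : X) (eps : R) (eps_gt0 : (0 < eps)%R) :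
  (forall h : X -> Y, calH X Y h ->
     first_order_approx eps f xbar h ->
     eps%:E < alpha0 h ->
     strongly_metrically_subregular f xbar /\
     subreg f xbar <= (alpha0 h - eps%:E)^-1) /\
  (strongly_metrically_subregular f xbar ->
   forall h : X -> Y, calH X Y h ->
     first_order_approx eps f xbar h ->
     eps%:E < (subreg f xbar)^-1 ->
     (subreg f xbar)^-1 - eps%:E <= alpha0 h /\
     strongly_metrically_subregular h 0%R).
Proof.
split=> [h Hh approx heps|sf h Hh approx eps_lt].
  have key b : (0 < b)%R -> (b + eps)%:E <= alpha0 h ->
      strongly_metrically_subregular f xbar /\ subreg f xbar <= (b^-1)%:E.
    exact: alpha0_strongly_subregular.
  case: (alpha0 h) heps key => [r| |]//.
    rewrite lte_fin => epsr /(_ (r - eps)%R).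
    by rewrite subr_gt0 subrK -EFinB inver subr_eq0 gt_eqF//; apply.
  move=> _ key; split; first by apply: (key 1%R _ _).1; rewrite ?leey.
  (* [key] at [e^-1] gives [subreg f xbar <= e] for every [e > 0]. *)
  rewrite invey; apply/lee_addgt0Pr => e e0; rewrite add0e -[e]invrK.
  by apply: (key e^-1%R _ _).2; rewrite ?invr_gt0 ?leey.
have le_alpha := alpha0_ge_subregV eps_gt0 Hh approx sf.
split=> //; apply: calH_strongly_subregular => //.
by apply: lt_le_trans le_alpha; rewrite sube_gt0.
Qed.
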